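(* For every infinite set $D\subseteq\omega$ with $0\notin D$, there exist a bounded complexity measure $\psi$ and a nonempty closed class $A$ of decision tables from $\mathcal{M}_k^2$ such that $G_{\psi,A}(n)=H_D(n)$ for every $n\in\omega$.
   Context: Fix an integer $k\ge 2$; $\omega=\{0,1,2,\ldots\}$, $E_k=\{0,1,\ldots,k-1\}$, $E_2=\{0,1\}$. Let $P=\{f_i:i\in\omega\}$ be a set of attribute names ($f_i\ne f_j$ for $i\ne j$). $\mathcal{M}_k^2$ is the set of rectangular tables filled with numbers from $E_k$ whose columns are labeled with pairwise different attributes from $P$, whose rows are pairwise different, and in which each row is labeled with a decision from $E_2$. Tables without rows also belong to $\mathcal{M}_k^2$ and are all denoted $\Lambda$. Tables differing only by a permutation of rows are equal. $P(T)$ is the set of column attributes. $\mathcal{M}_k^2\mathcal{C}$ is the set of tables in which all rows have the same decision ($\Lambda$ included). $T(f_{i_1},\delta_1)\cdots(f_{i_m},\delta_m)$ is the table of rows of $T$ having values $\delta_1,\ldots,\delta_m$ in the columns labeled $f_{i_1},\ldots,f_{i_m}$. Operations: for $D\subseteq P(T)$, $I(D,T)$ deletes the columns labeled by $D$ and, in each group of rows coinciding on the remaining columns, keeps one row with the minimum decision; $I(P(T),T)=\Lambda$. For $\nu:E_k^{|P(T)|}\to E_2$, $J(\nu,T)$ replaces the decision of each row $\bar\delta$ by $\nu(\bar\delta)$. $[T]=\{J(\nu,I(D,T)):D\subseteq P(T),\nu:E_k^{|P(T)\setminus D|}\to E_2\}$; $[A]=\bigcup_{T\in A}[T]$; nonempty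 $A$ is a closed class if $[A]=A$. A $k$-decision tree: finite directed rooted tree with at least two nodes, root and its leaving edges unlabeled, terminal nodes labeled with decisions from $E_2$, other nodes labeled with attributes from $P$ whose leaving edges are labeled with numbers from $E_k$; $P(\Gamma)$ is the set of attributes at nodes. For a complete path $\tau=v_1,d_1,\ldots,v_m,d_m,v_{m+1}$ (root to terminal node), $F(\tau)$ is the empty word if $m=1$, else $f_{i_2}\cdots f_{i_m}$ where $v_j$ is labeled $f_{i_j}$; $T(\tau)=T$ if $m=1$, else $T(f_{i_2},\delta_2)\cdots(f_{i_m},\delta_m)$ with $d_j$ labeled $\delta_j$. For $T\notin\mathcal{M}_k^2\mathcal{C}$, a strongly nondeterministic decision tree for $T$: all terminal nodes labeled $1$, $P(\Gamma)\subseteq P(T)$, every row with decision $1$ lies in some $T(\tau)$, and for every complete path either $T(\tau)=\Lambda$ or all rows of $T(\tau)$ have decision $1$. Let $B$ be the set of finite words over $P$ (with empty word $\lambda$). A complexity measure is $\psi:B\to\omega$ with $\psi(\alpha)=0$ iff $\alpha=\lambda$, invariant under permutation of letters, $\psi(\alpha_1)\le\psi(\alpha_1\alpha_2)\le\psi(\alpha_1)+\psi(\alpha_2)$; bounded if $\psi(\alpha)\ge|\alpha|$. For finite $D\subseteq P$: $\psi(\emptyset)=0$, $\psi(\{f_{i_1},\ldots,f_{i_m}\})=\psi(f_{i_1}\cdots f_{i_m})$. $\psi(\Gamma)=\max_\tau\psi(F(\tau))$ over complete paths. For $T\ne\Lambda$: $\psi^s(T)=0$ if $T\in\mathcal{M}_k^2\mathcal{C}$,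 otherwise the minimum of $\psi(\Gamma)$ over strongly nondeterministic decision trees for $T$; $W_\psi(T)=\psi(P(T))$; both $0$ on $\Lambda$. $G_{\psi,A}(n)=\max\{\psi^s(T):T\in A,W_\psi(T)\le n\}$. For infinite $D=\{n_i:i\in\omega\}\subseteq\omega$ with $n_i<n_{i+1}$: $H_D(n)=0$ if $n<n_0$, $H_D(n)=n_i$ if $n_i\le n<n_{i+1}$. *)

(* Defs.v *)
From HB Require Import structures.
From mathcomp Require Import all_boot finmap.
From mathcomp Require Import boolp classical_sets functions cardinality.

Set Implicit Arguments.
Unset Strict Implicit.
Unset Printing Implicit Defensive.

Local Open Scope classical_set_scope.
Local Open Scope fmap_scope.

(* The attribute name f_i is represented by its index i. *)
Notation attr := nat (only parsing).

(* Minimum and maximum of a set of natural numbers; both are 0 by default when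
   they do not exist (see natmin_spec, psi_s_attained and G_attained). *)
Definition natmin (S : set nat) : nat :=
  xget 0 [set m | S m /\ forall x, S x -> m <= x].
Definition natmax (S : set nat) : nat :=
  xget 0 [set m | S m /\ forall x, S x -> x <= m].

Section Tables.
Variable k : nat.

(* Decisions 0 and 1 are false and true, so minimum is conjunction. *)
Definition rowmap := {fmap seq 'I_k -> bool}.

(* A table is its sequence of column labels together with a finite map sending
   each row (read along the columns) to its decision, so that rows are pairwise
   different and unordered.  All tables without rows being equal to Lambda, and
   a table with rows having at least one column, we require that there are no
   rows exactly when there are no columns. *)
Definition table_ok (p : seq attr * rowmap) : bool :=
  [&& uniq p.1, all (fun r => size r == size p.1) (domf p.2)
    & (p.1 == [::]) == (p.2 == [fmap])].

Record table := Table { table_val : seq attr * rowmap; _ : table_ok table_val }.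

HB.instance Definition _ := [isSub for table_val].
HB.instance Definition _ := [Equality of table by <:].

Definition cols (T : table) : seq attr := (val T).1.
Definition rows (T : table) : rowmap := (val T).2.

Lemma Lambda_ok : table_ok ([::], [fmap]).
Proof. by rewrite /table_ok /= !eqxx. Qed.

Definition Lambda : table := Table Lambda_ok.

(* The table with columns cs and rows rs, read as Lambda when cs or rs is
   empty. *)
Definition mk_table (cs : seq attr) (rs : rowmap) : table :=
  insubd Lambda (cs, rs).

Definition in_C (T : table) : bool :=
  [forall r : domf (rows T), forall r' : domf (rows T),
     rows T r == rows T r'].

(* r has value p.2 in the column labeled p.1, for every letter p of w. *)
Definition agrees (T : table) (w : seq (attr * 'I_k)) (r : seq 'I_k) : bool :=
  all (fun p => p \in zip (cols T) r) w.

Definition subtable (T : table) (w : seq (attr * 'I_k)) : table :=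
  mk_table (cols T) (filterf (rows T) (agrees T w)).

Definition del_row (D : {fset attr}) (T : table) (r : seq 'I_k) : seq 'I_k :=
  mask [seq f \notin D | f <- cols T] r.

Definition opI (D : {fset attr}) (T : table) : table :=
  mk_table [seq f <- cols T | f \notin D]
    [fmap r' : [fset del_row D T r | r in domf (rows T)]%fset =>
       \big[andb/true]_(r : domf (rows T) | del_row D T (val r) == val r')
          rows T r].

(* Only the values of nu on the words of length size (cols T) matter. *)
Definition opJ (nu : seq 'I_k -> bool) (T : table) : table :=
  mk_table (cols T) [fmap r : domf (rows T) => nu (val r)].

Definition cl1 (T : table) : set table :=
  [set opJ nu (opI D T) | D in [set D : {fset attr} | {subset D <= cols T}]
                    & nu in [set: seq 'I_k -> bool]].

Definition cl (A : set table) : set table := \bigcup_(T in A) cl1 T.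

Definition closed_class (A : set table) : Prop := A !=set0 /\ cl A = A.

(* The subtree below a node other than the root; a nonterminal node has at
   least one outgoing edge, and several edges may carry the same number. *)
Inductive node : Type :=
| Terminal of bool
| Inner of attr & 'I_k * node & seq ('I_k * node).

(* The children of the root, of which there is at least one. *)
Record dtree := DTree { child : node; children : seq node }.

(* The complete paths from a node: the labels (f_{i_j}, delta_j) of the
   nonterminal nodes and of the edges leaving them, and the terminal label. *)
Fixpoint node_paths (v : node) : seq (seq (attr * 'I_k) * bool) :=
  match v with
  | Terminal d => [:: ([::], d)]
  | Inner f e es =>
      [seq ((f, e.1) :: p.1, p.2) | p <- node_paths e.2] ++
      flatten [seq [seq ((f, e'.1) :: p.1, p.2) | p <- node_paths e'.2]
              | e' <- es]
  end.

Definition paths (G : dtree) : seq (seq (attr * 'I_k) * bool) :=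
  flatten [seq node_paths v | v <- child G :: children G].

Fixpoint node_attrs (v : node) : seq attr :=
  match v with
  | Terminal _ => [::]
  | Inner f e es =>
      f :: node_attrs e.2 ++ flatten [seq node_attrs e'.2 | e' <- es]
  end.

Definition attrs (G : dtree) : seq attr :=
  flatten [seq node_attrs v | v <- child G :: children G].

Definition path_word (p : seq (attr * 'I_k) * bool) : seq attr :=
  [seq w.1 | w <- p.1].

Definition path_table (T : table) (p : seq (attr * 'I_k) * bool) : table :=
  subtable T p.1.

Definition strongly_nondet (T : table) (G : dtree) : Prop :=
  [/\ forall p, p \in paths G -> p.2 = true,
      {subset attrs G <= cols T},
      forall r, (rows T).[? r] = Some true ->
        exists2 p, p \in paths G & r \in domf (rows (path_table T p))
    & forall p, p \in paths G ->
        path_table T p = Lambda \/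
        forall r : domf (rows (path_table T p)),
          rows (path_table T p) r = true].

Definition complexity_measure (psi : seq attr -> nat) : Prop :=
  [/\ forall a, psi a = 0 <-> a = [::],
      forall a b, perm_eq a b -> psi a = psi b
    & forall a b, psi a <= psi (a ++ b) <= psi a + psi b].

Definition bounded (psi : seq attr -> nat) : Prop :=
  forall a, size a <= psi a.

Definition tree_complexity (psi : seq attr -> nat) (G : dtree) : nat :=
  \max_(p <- paths G) psi (path_word p).

Definition psi_s (psi : seq attr -> nat) (T : table) : nat :=
  if in_C T then 0
  else natmin [set tree_complexity psi G | G in strongly_nondet T].

(* cols T lists P(T) in some order, which is immaterial as psi is invariant
   under permutation of letters.  The value on Lambda is psi [::], which is 0 for a complexity measure. *)
Definition W_of (psi : seq attr -> nat) (T : table) : nat := psi (cols T).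

Definition G_of (psi : seq attr -> nat) (A : set table) (n : nat) : nat :=
  natmax [set psi_s psi T | T in A `&` [set T | W_of psi T <= n]].

End Tables.

(* D = {e 0 < e 1 < ...}. *)
Definition enumerates (e : nat -> nat) (D : set nat) : Prop :=
  (forall i, e i < e i.+1) /\ D = range e.

(* Every infinite D has an enumeration, and these clauses determine the value;
   see enumerates_ex, H_lt and H_step. *)
Definition H_of (D : set nat) (n : nat) : nat :=
  xget 0 [set m | exists2 e, enumerates e D &
    (n < e 0 /\ m = 0) \/ exists2 i, e i <= n < e i.+1 & m = e i].

Lemma natmin_spec (S : set nat) : S !=set0 ->
  S (natmin S) /\ forall x, S x -> natmin S <= x.
Proof.
move=> [x Sx].
have ex : exists m, `[< S m >] by exists x; apply/asboolP.
rewrite /natmin; apply: (@xgetPex _ 0 [set m | S m /\ _]).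
case: (ex_minnP ex) => m /asboolP Sm mmin.
by exists m; split=> // y Sy; apply: mmin; apply/asboolP.
Qed.

Lemma natmax_spec (S : set nat) b : S !=set0 -> (forall x, S x -> x <= b) ->
  S (natmax S) /\ forall x, S x -> x <= natmax S.
Proof.
move=> [x Sx] Sb.
have ex : exists m, `[< S m >] by exists x; apply/asboolP.
have bd m : `[< S m >] -> m <= b by move=> /asboolP/Sb.
rewrite /natmax; apply: (@xgetPex _ 0 [set m | S m /\ _]).
case: (ex_maxnP ex bd) => m /asboolP Sm mmax.
by exists m; split=> // y Sy; apply: mmax; apply/asboolP.
Qed.

Lemma enumerates_ex (D : set nat) : infinite_set D -> exists e, enumerates e D.
Proof.
move=> Dinf.
have next m : exists x, D x /\ m <= x.
  apply: contrapT => Nx; apply: Dinf.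
  apply: (sub_finite_set _ (finite_II m)) => x Dx /=.
  by rewrite ltnNge; apply/negP => mx; apply: Nx; exists x.
pose nx m := natmin [set x | D x /\ m <= x].
have nxP m : (D (nx m) /\ m <= nx m) /\
    forall x, D x /\ m <= x -> nx m <= x.
  exact: (natmin_spec (next m)).
pose e := fix e i := if i is j.+1 then nx (e j).+1 else nx 0.
have emono i : e i < e i.+1 by have [[]] := nxP (e i).+1.
exists e; split=> //; apply/seteqP; split=> [x Dx|x [i _ <-]]; last first.
  by case: i => [|i]; [have [[]] := nxP 0 | have [[]] := nxP (e i).+1].
have ei i : i <= e i by elim: i => // i IH; apply: leq_ltn_trans IH (emono i).
have ex : exists i, x <= e i by exists x; apply: ei.
case: (ex_minnP ex) => i xei imin; exists i => //.
apply/eqP; rewrite eqn_leq xei andbT.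
case: i xei imin => [|i] xei imin; first by have [_] := nxP 0; apply.
have [_] := nxP (e i).+1; apply; split=> //.
by rewrite ltnNge; apply/negP => /imin; rewrite ltnn.
Qed.

Lemma enumerates_uniq e e' D : enumerates e D -> enumerates e' D -> e = e'.
Proof.
have mono f : (forall i, f i < f i.+1) -> {mono f : i j / i <= j}.
  by move=> fS; apply/leq_mono/(homo_ltn ltn_trans).
have le f g : enumerates f D -> enumerates g D -> forall i, f i <= g i.
  move=> [/mono fm fD] [/mono gm gD].
  have fg i : exists j, f j = g i.
    have : D (g i) by rewrite gD; exists i.
    by rewrite fD => -[j _ <-]; exists j.
  have gmt := leqW_mono gm; have fmt := leqW_mono fm.
  elim=> [|i IH].
    by have [j <-] := fg 0; rewrite fm.
  have [j gj] := fg i.+1; rewrite -gj fm.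
  by rewrite -fmt gj (leq_ltn_trans IH) // gmt.
move=> eD e'D; apply/funext => i; apply/eqP.
by rewrite eqn_leq !le.
Qed.

Lemma H_lt e D n : enumerates e D -> n < e 0 -> H_of D n = 0.
Proof.
move=> eD n0; apply: xget_unique; first by exists e => //; left.
move=> y [e' e'D]; rewrite -(enumerates_uniq eD e'D) => -[[]//|].
move=> [i /andP[ein _] _]; exfalso.
have : e 0 <= e i.
  by apply: (homo_leq leqnn leq_trans) (leq0n i) => j; apply/ltnW/eD.1.
by move=> /leq_trans/(_ ein); rewrite leqNgt n0.
Qed.

Lemma H_step e D i n : enumerates e D -> e i <= n < e i.+1 -> H_of D n = e i.
Proof.
move=> eD /andP[ein nei]; apply: xget_unique.
  by exists e => //; right; exists i => //; rewrite ein.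
have em : {homo e : i j / i <= j}.
  by apply: (homo_leq leqnn leq_trans) => j; apply/ltnW/eD.1.
move=> y [e' e'D]; rewrite -(enumerates_uniq eD e'D) => -[[n0 _]|].
  by have := leq_trans (em 0 i (leq0n i)) ein; rewrite leqNgt n0.
move=> [j /andP[ejn nej] ->]; congr e; apply/eqP; rewrite eqn_leq.
apply/andP; split; rewrite leqNgt; apply/negP => /em ij.
  by have := leq_trans nei (leq_trans ij ejn); rewrite ltnn.
by have := leq_trans nej (leq_trans ij ein); rewrite ltnn.
Qed.

Section TableFacts.
Variable k : nat.
Implicit Types (T : table k) (D : {fset attr}) (nu : seq 'I_k -> bool).

Lemma table_ok_val T : table_ok (val T). Proof. exact: valP. Qed.

Lemma uniq_cols T : uniq (cols T).
Proof. by have /and3P[] := table_ok_val T. Qed.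

Lemma size_row T r : r \in rows T -> size r = size (cols T).
Proof. by have /and3P[_ /allP h _] := table_ok_val T => /h/eqP. Qed.

Lemma cols_rows0 T : (cols T == [::]) = (rows T == [fmap]).
Proof. by have /and3P[_ _ /eqP] := table_ok_val T. Qed.

Lemma mk_table_Lambda (cs : seq attr) (rs : rowmap k) :
  (cs == [::]) || (rs == [fmap]) -> mk_table cs rs = Lambda k.
Proof.
rewrite /mk_table => h; apply/val_inj; rewrite val_insubd.
case: ifP => // /and3P[_ _ /=].
by move: h => /orP[]/eqP ->; rewrite eqxx => /eqP h;
  congr pair; apply/eqP; rewrite -?h // h.
Qed.

Lemma val_mk_table (cs : seq attr) (rs : rowmap k) :
  uniq cs -> {in rs, forall r, size r = size cs} ->
  cs != [::] -> rs != [fmap] -> val (mk_table cs rs) = (cs, rs).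
Proof.
move=> ucs srs /negPf cs0 /negPf rs0.
rewrite /mk_table insubdK // /in_mem /= /table_ok /= ucs cs0 rs0 eqxx andbT.
by apply/allP => r /srs ->.
Qed.

Lemma rows_subtable T (w : seq (attr * 'I_k)) :
  rows (subtable T w) = filterf (rows T) (agrees T w).
Proof.
rewrite /subtable; have [f0|f0] := eqVneq (filterf (rows T) (agrees T w)) [fmap].
  by rewrite f0 mk_table_Lambda ?eqxx ?orbT.
rewrite /rows val_mk_table ?uniq_cols //.
  by move=> r; rewrite mem_filterf => /andP[/size_row].
apply: contraNneq f0 => c0; apply/eqP/fmapP => r.
have /eqP T0 : rows T == [fmap] by rewrite -cols_rows0 c0.
by rewrite fnd_filterf T0 fnd_fmap0 if_same.
Qed.

Lemma val_opI D T : ~~ all (mem D) (cols T) ->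
  val (opI D T) = ([seq f <- cols T | f \notin D],
    [fmap r' : [fset del_row D T r | r in domf (rows T)]%fset =>
       \big[andb/true]_(r : domf (rows T) | del_row D T (val r) == val r')
          rows T r]).
Proof.
move=> nD; apply: val_mk_table; first exact: filter_uniq (uniq_cols T).
- move=> r' /imfsetP[r /= rT ->].
  by rewrite filter_mask !size_mask ?size_map ?(size_row rT).
- by rewrite -has_filter -[has _ _]negbK -all_predC; apply: contra nD => /allP h;
    apply/allP => x /h /=; rewrite negbK.
apply: contraNneq nD => /(congr1 (fun f : rowmap k => domf f)) /= e.
suff /eqP -> : cols T == [::] by [].
rewrite cols_rows0; apply/eqP/fmapP => r; rewrite fnd_fmap0 not_fnd //.
apply/negP => rT; have : del_row D T r \in (fset0 : {fset seq 'I_k}).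
  by rewrite -[fset0]e; apply: in_imfset.
by rewrite inE.
Qed.

Lemma val_opJ nu T :
  val (opJ nu T) = (cols T, [fmap r : domf (rows T) => nu (val r)]).
Proof.
have [c0|c0] := eqVneq (cols T) [::].
  rewrite /opJ mk_table_Lambda ?c0 //; congr pair.
  have /eqP T0 : rows T == [fmap] by rewrite -cols_rows0 c0.
  by rewrite T0; apply/fmapP => r; rewrite fnd_fmap0 not_fnd //= inE.
apply: val_mk_table => //; rewrite ?uniq_cols //; first exact: size_row.
apply: contraNneq c0 => /(congr1 (fun f : rowmap k => domf f)) /= e.
rewrite cols_rows0; apply/eqP/fmapP => r; rewrite fnd_fmap0 not_fnd //.
apply/negP => rT; have : r \in (fset0 : {fset seq 'I_k}) by rewrite -[fset0]e.
by rewrite inE.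
Qed.

Lemma strongly_nondet_ex (psi : seq attr -> nat) T : ~~ in_C T ->
  exists2 t, strongly_nondet T t & tree_complexity psi t <= W_of psi T.
Proof.
pose chain := foldr (fun (w : attr * 'I_k) v => Inner w.1 (w.2, v) [::])
  (Terminal k true).
have chP w : node_paths (chain w) = [:: (w, true)].
  by elim: w => //= [[f d] w ->].
have chA w : node_attrs (chain w) = [seq x.1 | x <- w].
  by elim: w => //= [[f d] w ->]; rewrite cats0.
move=> nC.
pose rs : seq (seq 'I_k) := [seq r <- domf (rows T) | (rows T).[? r] == Some true].
have rs0 : rs != [::].
  apply: contra nC => /eqP rs0; apply/forallP => r; apply/forallP => r'.
  have F (s : domf (rows T)) : rows T s = false.
    apply/negP => /= st.
    have : val s \in rs by rewrite mem_filter (valP s) -Some_fnd st eqxx.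
    by rewrite rs0.
  by rewrite !F.
case E: rs rs0 => [//|r0 rs'] _.
pose ch r := chain (zip (cols T) r).
pose t := DTree (ch r0) [seq ch r | r <- rs'].
have tP : paths t = [seq (zip (cols T) r, true) | r <- rs].
  rewrite /paths E /= -!/(ch _) /ch chP /=; congr cons.
  by elim: rs' {E t} => //= r rs' ->; rewrite chP.
have rsT r : r \in rs -> r \in rows T by rewrite mem_filter => /andP[].
exists t; last first.
  apply/bigmax_leqP_seq => p; rewrite tP => /mapP[r rr ->] _.
  by rewrite /path_word -/(unzip1 _) unzip1_zip // (size_row (rsT _ rr)).
have agE r r' : r \in rows T -> r' \in rows T ->
    agrees T (zip (cols T) r) r' -> r' = r.
  move=> rT r'T /allP h.
  have sz := size_row rT; have sz' := size_row r'T.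
  have e : size r' = size r by rewrite sz.
  case: (posnP (size r)) => [r00|rp].
    by rewrite (size0nil r00); apply/size0nil; rewrite e.
  have d0 : 'I_k by case: r rp {h rT sz e}.
  apply: (@eq_from_nth _ d0) => // i; rewrite e => ir.
  have ic : i < size (cols T) by rewrite -sz.
  have := h (nth 0 (cols T) i, nth d0 r i).
  rewrite -nth_zip ?sz // mem_nth ?size_zip ?sz ?minnn // => /(_ isT).
  rewrite nth_zip // => /(nthP (0, d0))[j]; rewrite size_zip sz' minnn => jc.
  rewrite nth_zip // => -[/eqP]; rewrite nth_uniq ?uniq_cols // => /eqP -> //.
have ag r : agrees T (zip (cols T) r) r by apply/allP.
split.
- by move=> p; rewrite tP => /mapP[r _ ->].
- have -> : attrs t = flatten [seq unzip1 (zip (cols T) r) | r <- rs].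
    by rewrite /attrs E /= /ch chA -map_comp; congr (_ ++ flatten _);
      apply: eq_map => r /=; rewrite chA.
  move=> f /flatten_mapP[r rr].
  by rewrite unzip1_zip // (size_row (rsT _ rr)).
- move=> r rT; have rd : r \in rows T by apply: contraPT rT => /not_fnd ->.
  exists (zip (cols T) r, true).
    by rewrite tP map_f // mem_filter rT eqxx.
  by rewrite /path_table rows_subtable mem_filterf rd ag.
- move=> p; rewrite tP => /mapP[r rr ->]; right=> -[/= r' r'T].
  apply: Some_inj; rewrite Some_fnd /=; move: (r'T).
  rewrite rows_subtable mem_filterf => /andP[r'd h].
  rewrite fnd_filterf (agE r r' (rsT _ rr) r'd h) ag.
  by move: rr; rewrite mem_filter => /andP[/eqP].
Qed.

Lemma psi_s_attained (psi : seq attr -> nat) T : ~~ in_C T ->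
  let S := [set tree_complexity psi t | t in strongly_nondet T] in
  S (psi_s psi T) /\ forall x, S x -> psi_s psi T <= x.
Proof.
move=> nC; rewrite /psi_s (negPf nC); apply: natmin_spec.
by have [t tT _] := strongly_nondet_ex psi nC; exists (tree_complexity psi t), t.
Qed.

Lemma psi_s_le_W (psi : seq attr -> nat) T : psi_s psi T <= W_of psi T.
Proof.
have [TC|nC] := boolP (in_C T); first by rewrite /psi_s TC.
have [t tT] := strongly_nondet_ex psi nC; apply: leq_trans.
by apply: (psi_s_attained psi nC).2; exists t.
Qed.

Lemma G_attained (psi : seq attr -> nat) (A : set (table k)) n :
  complexity_measure psi -> closed_class A ->
  let S := [set psi_s psi T | T in A `&` [set T | W_of psi T <= n]] in
  S (G_of psi A n) /\ forall x, S x -> x <= G_of psi A n.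
Proof.
move=> [psi0 _ _] [[T AT] clA]; apply: (@natmax_spec _ n).
  exists (psi_s psi (Lambda k)), (Lambda k) => //; split; last first.
    by rewrite /= /W_of (psi0 _).2.
  rewrite -clA; exists T => //.
  exists [fset f in cols T]%fset; first by move=> f; rewrite inE.
  exists (fun=> false) => //.
  have -> : opI [fset f in cols T]%fset T = Lambda k.
    apply: mk_table_Lambda; apply/orP; left; apply/eqP.
    by rewrite -(filter_pred0 (cols T)); apply: eq_in_filter => f fT; rewrite inE fT.
  exact/mk_table_Lambda.
by move=> _ [T' [_ /= WT] <-]; apply: leq_trans WT; apply: psi_s_le_W.
Qed.

End TableFacts.

(* Main.v *)
(* Give the attribute f_i the weight n_i, where D = {n_0 < n_1 < ...}, let psi
   be the sum of the weights of the letters of a word, and let A consist of the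
   tables with at most one column.  A table T of A whose column is f_i
   satisfies psi^s(T) <= W(T) = n_i; equality holds for the table with rows
   0, 1 and decisions 0, 1, whose rows can only be separated by querying f_i. *)
Require Import Defs.
From mathcomp Require Import all_boot finmap.
From mathcomp Require Import boolp classical_sets functions cardinality.
Local Open Scope classical_set_scope.

Definition weight (e : nat -> nat) (a : seq nat) : nat := \sum_(i <- a) e i.

Lemma weight_complexity_measure (e : nat -> nat) :
  (forall i, 0 < e i) -> complexity_measure (weight e).
Proof.
move=> e_gt0; split.
- move=> [|i a]; first by rewrite /weight big_nil.
  by split=> // /eqP; rewrite /weight big_cons addn_eq0 -leqn0 leqNgt e_gt0.
- by move=> a b; apply: perm_big.
- by move=> a b; rewrite /weight big_cat leq_addr leqnn.
Qed.

Lemma weight_bounded (e : nat -> nat) :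
  (forall i, 0 < e i) -> bounded (weight e).
Proof. by move=> e_gt0 a; rewrite -sum1_size; apply: leq_sum. Qed.

Lemma opJ_opI0 (k : nat) (T : table k) :
  opJ (fun r => odflt false (rows T).[? r]%fmap) (opI fset0 T) = T.
Proof.
apply/val_inj; rewrite val_opJ.
(* [val_opI] needs a surviving column, so the table without columns is treated apart. *)
have [c0|c0] := boolP (all (mem (fset0 : {fset nat})) (cols T)).
  have {}c0 : cols T = [::] by case: (cols T) c0.
  have r0 : rows T = [fmap]%fmap by apply/eqP; rewrite -cols_rows0 c0.
  rewrite /opI mk_table_Lambda ?c0 //.
  rewrite [RHS]surjective_pairing -/(cols T) -/(rows T) c0 r0; congr pair.
  by apply/fmapP => r; rewrite fnd_fmap0 not_fnd //= inE.
rewrite {1}/cols /rows val_opI //=.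
have keep : [seq f \notin (fset0 : {fset nat}) | f <- cols T]
    = nseq (size (cols T)) true.
  by elim: (cols T) => //= f s ->.
have dE r : r \in rows T -> del_row fset0 T r = r.
  by move=> rT; rewrite /del_row keep -(size_row rT) mask_true.
rewrite [RHS]surjective_pairing -/(cols T) -/(rows T); congr pair.
  by apply/all_filterP/allP.
apply/fmapP => r; have [rT|rT] := boolP (r \in rows T).
  have rI : r \in [fset del_row fset0 T r | r in domf (rows T)]%fset.
    by apply/imfsetP; exists r => //=; rewrite dE.
  by rewrite in_fnd /= ffunE /= (in_fnd rT).
rewrite [RHS]not_fnd // not_fnd //=; apply: contra rT => /imfsetP[r' /= r'T ->].
by rewrite dE.
Qed.

(** Neither operation adds columns, and [opJ_opI0] gives the converse inclusion. *)
Lemma size_cols_le_closed_class (k m : nat) :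
  closed_class [set T : table k | size (cols T) <= m].
Proof.
split; first by exists (Lambda k).
apply/seteqP; split=> [_ [T /= Tm] [E _ [nu _ <-]]|T /= Tm].
  rewrite {1}/cols val_opJ /=.
  have [TE|TE] := boolP (all (mem E) (cols T)); last first.
    rewrite {1}/cols val_opI //=; apply: leq_trans Tm.
    by rewrite size_filter count_size.
  rewrite /opI mk_table_Lambda //; apply/orP; left.
  by rewrite -[_ == _]negbK -has_filter -all_predC; apply/allP => f
    /(allP TE) /= ->.
exists T => //; exists fset0 => //.
by exists (fun r => odflt false (rows T).[? r]%fmap) => //; apply: opJ_opI0.
Qed.

Section TwoRowTable.
Variables (k : nat) (f : nat) (x0 x1 : 'I_k).
Hypothesis x01 : x0 != x1.

Let rs : rowmap k :=
  [fmap r : [fset [:: x0]; [:: x1]]%fset => val r == [:: x1]]%fmap.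

Definition two_row_table : table k := mk_table [:: f] rs.

Lemma val_two_row_table : val two_row_table = ([:: f], rs).
Proof.
apply: val_mk_table => //.
  by move=> r /=; rewrite !inE => /orP[]/eqP ->.
(* The row [[:: x0]] keeps [mk_table] from collapsing to [Lambda]. *)
apply/eqP => /(congr1 (fun g : rowmap k => [:: x0] \in g)) /=.
by rewrite !inE eqxx.
Qed.

Lemma cols_two_row_table : cols two_row_table = [:: f].
Proof. by rewrite /cols val_two_row_table. Qed.

Lemma two_row_table0 : (rows two_row_table).[? [:: x0]]%fmap = Some false.
Proof.
rewrite /rows val_two_row_table.
have x0r : [:: x0] \in rs by rewrite !inE eqxx.
by rewrite (in_fnd x0r) ffunE /= eqseq_cons (negPf x01).
Qed.

Lemma two_row_table1 : (rows two_row_table).[? [:: x1]]%fmap = Some true.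
Proof.
rewrite /rows val_two_row_table.
have x1r : [:: x1] \in rs by rewrite !inE eqxx orbT.
by rewrite (in_fnd x1r) ffunE /= eqxx.
Qed.

Lemma two_row_table_notin_C : ~~ in_C two_row_table.
Proof.
apply/negP => /forallP C.
have in0 : [:: x0] \in rows two_row_table.
  by apply: contraPT two_row_table0 => /not_fnd ->.
have in1 : [:: x1] \in rows two_row_table.
  by apply: contraPT two_row_table1 => /not_fnd ->.
have /forallP/(_ [` in1]%fset)/eqP e := C [` in0]%fset.
have := congr1 Some e.
by rewrite !Some_fnd two_row_table0 two_row_table1.
Qed.

(** For the lower bound, take an optimal tree and its path covering the row [[:: x1]]: this path
    must query [f]. *)
Lemma psi_s_two_row_table (e : nat -> nat) :
  psi_s (weight e) two_row_table = e f.
Proof.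
apply/eqP; rewrite eqn_leq; apply/andP; split.
  apply: leq_trans (psi_s_le_W _ _) _.
  by rewrite /W_of cols_two_row_table /weight big_seq1.
have [[t [_ _ cover sound] <-] _] :=
  psi_s_attained (weight e) two_row_table_notin_C.
have [[w d] pt] := cover _ two_row_table1.
rewrite /path_table rows_subtable mem_filterf => /andP[_ /= ag1].
apply: leq_trans (leq_bigmax_seq _ pt isT).
(* A nonempty path starts with [f], the only column, and so weighs at least [e f]. An empty path
   keeps the row [[:: x0]], whose decision 0 contradicts [sound]. *)
case: w pt ag1 => [|[g x] w] pt ag1 /=; last first.
  move: ag1; rewrite /agrees cols_two_row_table /= inE => /andP[/eqP[-> _] _].
  by rewrite /weight big_cons leq_addr.
have in0 : [:: x0] \in rows (path_table two_row_table ([::], d)).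
  rewrite /path_table rows_subtable mem_filterf andbT.
  by apply: contraPT two_row_table0 => /not_fnd ->.
have [T0|all1] := sound _ pt; first by rewrite T0 in in0.
have := congr1 Some (all1 [` in0]%fset).
by rewrite Some_fnd /= /path_table rows_subtable fnd_filterf /= two_row_table0.
Qed.

End TwoRowTable.

Theorem theorem9 (k : nat) (hk : 2 <= k) (D : set nat) (hD : infinite_set D)
  (hD0 : ~ D 0) :
  exists (psi : seq nat -> nat) (A : set (table k)),
    [/\ complexity_measure psi, bounded psi, closed_class A
      & forall n : nat, G_of psi A n = H_of D n].
Proof.
have [e eD] := enumerates_ex hD.
have e_lt := eD.1.
have De i : D (e i) by rewrite eD.2; exists i.
(* This is where 0 lying outside [D] enters: positive weights make [weight e] a bounded complexity
   measure. *)
have e_gt0 i : 0 < e i.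
  by rewrite lt0n; apply/eqP => ei0; apply: hD0; rewrite -ei0.
have e_le : {homo e : i j / i <= j}.
  by apply: (homo_leq leqnn leq_trans) => i; apply/ltnW.
have le_e i : i <= e i by elim: i => // i IH; apply: leq_ltn_trans IH (e_lt i).
have psiP := weight_complexity_measure _ e_gt0.
have AP := @size_cols_le_closed_class k 1.
exists (weight e), [set T : table k | size (cols T) <= 1].
split=> //; first exact: weight_bounded.
move=> n; have [] := G_attained n psiP AP.
set G := G_of _ _ _ => -[T [/= T1 Tn] TG] Gmax.
have [n0|n0] := ltnP n (e 0).
  (* Any single column weighs at least [e 0], so only tables without columns fit the budget [n]. *)
  rewrite (H_lt eD n0); apply/eqP; rewrite -leqn0 -TG.
  apply: leq_trans (psi_s_le_W _ _) _.
  move: T1 Tn; rewrite /W_of; case: (cols T) => [|i []] //= _.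
    by rewrite /weight big_nil.
  rewrite /weight big_seq1 => ein.
  by have := leq_trans (e_le 0 i (leq0n i)) ein; rewrite leqNgt n0.
have ex : exists i, e i <= n by exists 0.
(* Bounds the indices with [e i <= n], so that a largest one exists. *)
have bd i : e i <= n -> i <= n by apply: leq_trans.
case: (ex_maxnP ex bd) => i ein imax.
have nei : n < e i.+1 by rewrite ltnNge; apply/negP => /imax; rewrite ltnn.
(* Upper bound: a column [j] within the budget has [j <= i] by maximality of [i]. *)
rewrite (@H_step e D i) ?ein //; apply/eqP; rewrite eqn_leq; apply/andP; split.
  rewrite -TG; apply: leq_trans (psi_s_le_W _ _) _.
  move: T1 Tn; rewrite /W_of; case: (cols T) => [|j []] //= _.
    by rewrite /weight big_nil.
  by rewrite /weight big_seq1 => /imax/e_le.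
(* Lower bound: [hk] supplies two distinct values, and the two-row table on column [i] attains
   [e i]. *)
pose x0 : 'I_k := Ordinal (ltnW hk); pose x1 : 'I_k := Ordinal hk.
apply: Gmax; exists (two_row_table k i x0 x1); last first.
  exact: psi_s_two_row_table.
by split; rewrite /= /W_of cols_two_row_table // /weight big_seq1.
Qed.
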